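(* Let $R(q)=\dfrac{(q;q^5)_\infty(q^4;q^5)_\infty}{(q^2;q^5)_\infty(q^3;q^5)_\infty}$ and define the coefficients $D(n)$, $n\ge 0$, by the power series expansion $$\frac{R(q^5)}{R^5(q)}=\sum_{n=0}^{\infty}D(n)q^n,\qquad |q|<1.$$ Then $D(1)>0$.
   Context: For complex numbers $a,q$ with $|q|<1$, $(a;q)_\infty:=\prod_{k=0}^{\infty}(1-aq^k)$. The function $R(q)$ is the Rogers-Ramanujan continued fraction without its factor $q^{1/5}$, i.e. $R(q)=\cfrac{1}{1+\cfrac{q}{1+\cfrac{q^2}{1+\cfrac{q^3}{1+\cdots}}}}$, which equals the infinite product $\dfrac{(q;q^5)_\infty(q^4;q^5)_\infty}{(q^2;q^5)_\infty(q^3;q^5)_\infty}$ (a classical identity of Rogers and Ramanujan). Here $R^5(q)$ denotes $(R(q))^5$, and $R(q^5)$ denotes $R$ evaluated at $q^5$. *)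

(* Defs.v *)
From HB Require Import structures.
From mathcomp Require Import all_boot all_order all_algebra.
From mathcomp Require Import complex.
From mathcomp Require Import reals topology normedtype sequences.
Set Implicit Arguments.
Unset Strict Implicit.
Unset Printing Implicit Defensive.
Import Order.TTheory GRing.Theory Num.Theory.
Import numFieldNormedType.Exports.
Local Open Scope classical_set_scope.
Local Open Scope ring_scope.
Local Open Scope complex_scope.

(* The topology of the complex numbers R[i] (that of the modulus) is declared
   on the alias R[i]^o only, hence the casts to R[i]^o under limits. *)

(* (a; q)_oo *)
Definition qpochhammer (R : realType) (a q : R[i]) : R[i] :=
  limn (fun n => \prod_(0 <= k < n) (1 - a * q ^+ k) : R[i]^o).

Definition rogers_ramanujan (R : realType) (q : R[i]) : R[i] :=
  (qpochhammer q (q ^+ 5) * qpochhammer (q ^+ 4) (q ^+ 5)) /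
  (qpochhammer (q ^+ 2) (q ^+ 5) * qpochhammer (q ^+ 3) (q ^+ 5)).

(* D n is the coefficient of q ^ n in the power series expansion of f on the
   open unit disc. *)
Definition has_expansion (R : realType) (f : R[i] -> R[i])
    (D : nat -> R[i]) : Prop :=
  forall q : R[i], `|q| < 1 ->
    series (fun n => D n * q ^+ n : R[i]^o) @ \oo --> (f q : R[i]^o).

(* Main.v *)
(* Up to terms of order q^2 only the factor 1 - q of (q; q^5)_oo contributes to
   R(q), so R(q) = 1 - q + O(q^2), while R(q^5) = 1 + O(q^5); hence the quotient
   is 1 + 5 q + O(q^2) and D(1) = 5.  It suffices to let q tend to 0 through
   positive reals: there the partial products are monotone, with
   1 - a / (1 - q) <= (a; q)_oo <= 1 - a, and the first two coefficients of a
   power series are determined by its one-sided expansion at 0. *)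

Require Import Defs.
From HB Require Import structures.
From mathcomp Require Import all_boot all_order all_algebra.
From mathcomp Require Import complex.
From mathcomp Require Import reals topology normedtype sequences.
From mathcomp Require Import boolp classical_sets realfun.
From mathcomp Require Import ring lra.
Set Implicit Arguments.
Unset Strict Implicit.
Unset Printing Implicit Defensive.
Import Order.TTheory GRing.Theory Num.Theory.
Import numFieldNormedType.Exports.
Local Open Scope ring_scope.
Local Open Scope complex_scope.

(** * Limits in [R[i]] and limits of real and imaginary parts *)

Section ComplexLimits.
Variable R : realType.

Lemma cvg_real_complex (u : nat -> R) (l : R) :
  (u n @[n --> \oo] --> l)%classic ->
  ((fun n => (u n)%:C : R[i]^o) n @[n --> \oo] --> (l%:C : R[i]^o))%classic.
Proof.
move=> /cvgrPdist_lt ul; apply/cvgrPdist_lt => -[e e'].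
(* The order on [R[i]] relates only numbers with equal imaginary parts, so a positive [e] is
   real. *)
rewrite ltcE /= => /andP[/eqP -> e0].
move: (ul e e0); apply: filterS => n.
rewrite -rmorphB normc_def /= expr0n addr0 sqrtr_sqr ltcE /= eqxx.
by [].
Qed.

Lemma cvg_Re (u : nat -> R[i]) (l : R[i]) :
  ((fun n => u n : R[i]^o) n @[n --> \oo] --> (l : R[i]^o))%classic ->
  (complex.Re (u n) @[n --> \oo] --> complex.Re l)%classic.
Proof.
move=> /cvgrPdist_lt ul; apply/cvgrPdist_lt => e e0.
have e0' : 0 < e%:C by rewrite ltcE /= eqxx.
move: (ul _ e0'); apply: filterS => n /(le_lt_trans (normc_ge_Re _)).
by rewrite ltcE /= eqxx; case: (l) (u n) => a b [].
Qed.

Lemma cvg_Im (u : nat -> R[i]) (l : R[i]) :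
  ((fun n => u n : R[i]^o) n @[n --> \oo] --> (l : R[i]^o))%classic ->
  (complex.Im (u n) @[n --> \oo] --> complex.Im l)%classic.
Proof.
move=> /cvgrPdist_lt ul; apply/cvgrPdist_lt => e e0.
have e0' : 0 < e%:C by rewrite ltcE /= eqxx.
have normc_ge_Im (z : R[i]) : `|complex.Im z|%:C <= `|z|.
  by case: z => a b; simpc; rewrite -sqrtr_sqr ler_wsqrtr // lerDr sqr_ge0.
move: (ul _ e0'); apply: filterS => n /(le_lt_trans (normc_ge_Im _)).
by rewrite ltcE /= eqxx; case: (l) (u n) => a b [].
Qed.

End ComplexLimits.

(** * First-order expansions at 0 from the right *)

Section RightSlope.
Variable R : realType.
Implicit Types (f g : R -> R) (a b c : R).

(** Convergence at 1/2 bounds [c n * 2^-1 ^+ n] by some [M]. For [t <= 4^-1] the terms after the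
    first are then dominated by a geometric series of ratio [2 * t], and [g t] differs from [c 0] by
    at most [4 * M * t]. *)
Lemma cvg_power_series_right (c : nat -> R) g :
  (forall t, 0 < t < 1 ->
     (series (fun n => c n * t ^+ n) @ \oo --> g t)%classic) ->
  (g t @[t --> 0^'+] --> c 0%N)%classic.
Proof.
move=> cg.
have h01 : 0 < (2^-1 : R) < 1 by lra.
have [M [M0 HM]] : exists M : R, 0 <= M /\ forall n, `|c n * 2^-1 ^+ n| <= M.
  have /cvg_seq_bounded [M [Mr HM]] : cvgn (fun n => c n * 2^-1 ^+ n).
    by apply: cvgP; apply: cvg_series_cvg_0; apply: cvgP; exact: cg h01.
  (* Boundedness says that every number strictly above [M] is a bound; this one is also
     nonnegative. *)
  have M1 : M < `|M| + 1 by rewrite ltr_pwDr // ler_norm.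
  by exists (`|M| + 1); split; [rewrite addr_ge0 | move=> n; exact: HM].
have tail t n : 0 < t <= 4^-1 ->
    `|c 0%N - series (fun n => c n * t ^+ n) n.+1| <= 4 * M * t.
  move=> /andP[t0 t1].
  rewrite seriesEnat /= big_nat_recl // expr0 mulr1 opprD addNKr normrN.
  apply: (@le_trans _ _ (series (geometric (M * (2 * t)) (2 * t)) n)).
    rewrite seriesEnat /= (le_trans (ler_norm_sum _ _ _)) //.
    apply: ler_sum => k _; rewrite -mulrA -exprS exprMn.
    have -> : c k.+1 * t ^+ k.+1 = c k.+1 * 2^-1 ^+ k.+1 * (2 ^+ k.+1 * t ^+ k.+1).
      by rewrite -mulrA (mulrA (2^-1 ^+ _)) -exprMn mulVf ?pnatr_eq0 // expr1n mul1r.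
    have p0 : 0 <= 2 ^+ k.+1 * t ^+ k.+1 by rewrite mulr_ge0 // exprn_ge0 // ltW.
    by rewrite normrM (ger0_norm p0) ler_wpM2r.
  apply: (le_trans (geometric_le_lim _ _ _ _)); rewrite ?ger0_norm; try lra.
    by rewrite mulr_ge0 //; lra.
  (* This is where [t <= 4^-1] enters: [1 - 2 * t] is at least 1/2. *)
  have i2 : (1 - 2 * t)^-1 <= 2.
    by rewrite invf_ple ?posrE; lra.
  apply: (@le_trans _ _ (M * (2 * t) * 2)); last by lra.
  by rewrite ler_wpM2l // mulr_ge0 //; lra.
have bound t : 0 < t <= 4^-1 -> `|c 0%N - g t| <= 4 * M * t.
  move=> t01.
  have ct : (series (fun n => c n * t ^+ n) n.+1 @[n --> \oo] --> g t)%classic.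
    by have := cg t; rewrite -cvg_shiftS; apply; lra.
  have cn : (`|c 0%N - series (fun n => c n * t ^+ n) n.+1| @[n --> \oo] --> `|c 0%N - g t|)%classic.
    by apply: cvg_norm; apply: cvgB => //; exact: cvg_cst.
  rewrite -(cvg_lim (@Rhausdorff R) cn); apply: limr_le; first exact: cvgP cn.
  by apply: nearW => n; exact: tail.
(* The added 1 keeps the divisor of [e] positive when [M] is 0. *)
have M4 : 0 < 4 * M + 1 by lra.
apply/cvgrPdist_lt => e e0; near=> t.
have t0 : 0 < t by near: t; exact: nbhs_right_gt.
have t1 : t <= 4^-1 by near: t; apply: nbhs_right_le; lra.
have te : t < e / (4 * M + 1) by near: t; apply: nbhs_right_lt; exact: divr_gt0.
rewrite (le_lt_trans (bound t _)) ?t0 //.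
by move: te; rewrite ltr_pdivlMr //; lra.
Unshelve. all: by end_near. Qed.

(** Encodes [f t = a + b * t + o(t)] for [t] tending to 0 through positive values. *)
Definition right_slope f a b : Prop :=
  ((f t - a) / t @[t --> 0^'+] --> b)%classic.

Lemma near_right_neq0 : (\forall t \near 0^'+, t != 0 :> R)%classic.
Proof.
by near=> t; rewrite gt_eqF //; near: t; exact: nbhs_right_gt.
Unshelve. all: by end_near. Qed.

Lemma cvg_idr : ((t : R) @[t --> 0^'+] --> (0 : R))%classic.
Proof. by apply: cvg_at_right_filter; exact: cvg_id. Qed.

Lemma right_slope_cvg {f a b} :
  right_slope f a b -> (f t @[t --> 0^'+] --> a)%classic.
Proof.
move=> fab.
have H : ((f t - a) / t * t + a @[t --> 0^'+] --> b * 0 + a)%classic.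
  by apply: cvgD; [apply: cvgM fab _; exact: cvg_idr | exact: cvg_cst].
rewrite mulr0 add0r in H; apply: cvg_trans H; apply: near_eq_cvg.
by apply: filterS near_right_neq0 => t t0; rewrite divfK // subrK.
Qed.

Lemma right_slope_unique f a b a' b' :
  right_slope f a b -> right_slope f a' b' -> a = a' /\ b = b'.
Proof.
move=> f1 f2.
have aa := cvg_unique (@Rhausdorff R) (right_slope_cvg f1) (right_slope_cvg f2).
by move: f2; rewrite -aa => /(cvg_unique (@Rhausdorff R) f1).
Qed.

Lemma right_slope_cst a : right_slope (fun=> a) a 0.
Proof.
by rewrite /right_slope subrr; under eq_fun do rewrite mul0r; exact: cvg_cst.
Qed.

Lemma right_slopeM f g a b a' b' : right_slope f a b -> right_slope g a' b' ->
  right_slope (fun t => f t * g t) (a * a') (a * b' + b * a').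
Proof.
move=> f1 g1; have f0 := right_slope_cvg f1.
have H : (f t * ((g t - a') / t) + (f t - a) / t * a' @[t --> 0^'+]
    --> a * b' + b * a')%classic.
  by apply: cvgD; apply: cvgM => //; exact: cvg_cst.
by apply: cvg_trans H; apply: near_eq_cvg; apply: nearW => t; ring.
Qed.

Lemma right_slopeV f b : right_slope f 1 b ->
  right_slope (fun t => (f t)^-1) 1 (- b).
Proof.
move=> f1; have f0 := right_slope_cvg f1.
have H : (- ((f t - 1) / t * (f t)^-1) @[t --> 0^'+] --> - (b * 1^-1))%classic.
  by apply: cvgN; apply: cvgM => //; apply: cvgV => //; exact: oner_neq0.
rewrite invr1 mulr1 in H; apply: cvg_trans H; apply: near_eq_cvg.
have fn0 : (\forall t \near 0^'+, f t != 0)%classic.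
  by apply: (cvgr_neq0 _ f0); exact: oner_neq0.
apply: filterS2 fn0 near_right_neq0 => t ft t0.
by field; rewrite ft t0.
Qed.

Lemma right_slopeX f b n : right_slope f 1 b ->
  right_slope (fun t => f t ^+ n) 1 (b *+ n).
Proof.
move=> f1; elim: n => [|n IH].
  by rewrite mulr0n; under eq_fun do rewrite expr0; exact: right_slope_cst.
under eq_fun do rewrite exprS.
by move: (right_slopeM f1 IH); rewrite !(mulr1, mul1r) -mulrSr.
Qed.

(** The quotient [(g t - c 0) / t] is itself the sum of a power series, with coefficients [c n.+1],
    so its limit is the constant term [c 1]. *)
Lemma power_series_right_slope (c : nat -> R) g :
  (forall t, 0 < t < 1 ->
     (series (fun n => c n * t ^+ n) @ \oo --> g t)%classic) ->
  right_slope g (c 0%N) (c 1%N).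
Proof.
move=> cg; apply: (@cvg_power_series_right (fun n => c n.+1)) => t t01.
have t0 : t != 0 by rewrite gt_eqF //; case/andP: t01.
have H : ((series (fun n => c n * t ^+ n) n.+1 - c 0%N) / t @[n --> \oo]
    --> (g t - c 0%N) / t)%classic.
  apply: cvgM; last exact: cvg_cst.
  apply: cvgB; last exact: cvg_cst.
  by have := cg t t01; rewrite -cvg_shiftS.
apply: cvg_trans H; apply: near_eq_cvg; apply: nearW => n.
rewrite !seriesEnat /= big_nat_recl // expr0 mulr1 addrC addKr mulr_suml.
by apply: eq_bigr => k _; rewrite exprS; field.
Qed.

End RightSlope.

(** * Real q-Pochhammer products and the Rogers-Ramanujan quotient *)

Section RealProducts.
Variable R : realType.
Implicit Types a q t : R.

Definition real_qpochhammer a q : R :=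
  limn (fun n => \prod_(0 <= k < n) (1 - a * q ^+ k)).

Lemma partial_qpochhammer_ge0 a q n : 0 <= a < 1 -> 0 <= q < 1 ->
  0 <= \prod_(0 <= k < n) (1 - a * q ^+ k).
Proof.
move=> a01 q01; apply: prodr_ge0 => k _; rewrite subr_ge0.
by rewrite mulr_ile1 ?exprn_ge0 ?exprn_ile1 //; lra.
Qed.

Lemma partial_qpochhammer_ge a q n : 0 <= a < 1 -> 0 <= q < 1 ->
  1 - a / (1 - q) <= \prod_(0 <= k < n) (1 - a * q ^+ k).
Proof.
move=> a01 q01; have [a0 q0] : 0 <= a /\ 0 <= q by lra.
have q1 : 1 - q != 0 by lra.
(* The upper bound 1 is carried through the induction: it ensures that the factor [1 - a * q ^+ n]
   lowers the product by at most [a * q ^+ n], and these losses sum to a geometric series. *)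
have : 1 - a * (1 - q ^+ n) / (1 - q) <= \prod_(0 <= k < n) (1 - a * q ^+ k) <= 1.
  elim: n => [|n /andP[IH1 IH2]].
    by rewrite big_nil expr0 subrr mulr0 mul0r subr0 lexx.
  rewrite big_nat_recr //=; set P := \prod_(_ <= _ < _) _ in IH1 IH2 *.
  have P0 : 0 <= P by exact: partial_qpochhammer_ge0.
  have x0 : 0 <= a * q ^+ n by rewrite mulr_ge0 // exprn_ge0.
  have -> : 1 - a * (1 - q ^+ n.+1) / (1 - q)
      = 1 - a * (1 - q ^+ n) / (1 - q) - a * q ^+ n by rewrite exprS; field.
  by nra.
move=> /andP[+ _]; apply: le_trans.
rewrite lerD2l lerN2 ler_wpM2r ?invr_ge0; try lra.
by rewrite -[leRHS]mulr1 ler_wpM2l // gerBl exprn_ge0.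
Qed.

Lemma nonincreasing_partial_qpochhammer a q : 0 <= a < 1 -> 0 <= q < 1 ->
  nonincreasing_seq (fun n => \prod_(0 <= k < n) (1 - a * q ^+ k)).
Proof.
move=> a01 q01; apply/nonincreasing_seqP => n.
rewrite big_nat_recr //= -[leRHS]mulr1 ler_wpM2l ?partial_qpochhammer_ge0 //.
by rewrite gerBl mulr_ge0 ?exprn_ge0 //; lra.
Qed.

(** The partial products are nonincreasing and bounded below by 0, so the [limn] in the definition
    is a genuine limit. *)
Lemma cvg_real_qpochhammer a q : 0 <= a < 1 -> 0 <= q < 1 ->
  (\prod_(0 <= k < n) (1 - a * q ^+ k) @[n --> \oo]
     --> real_qpochhammer a q)%classic.
Proof.
move=> a01 q01; apply: nonincreasing_is_cvgn.
  exact: nonincreasing_partial_qpochhammer.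
by exists 0 => _ [n _ <-]; exact: partial_qpochhammer_ge0.
Qed.

Lemma real_qpochhammer_bounds a q : 0 <= a < 1 -> 0 <= q < 1 ->
  1 - a / (1 - q) <= real_qpochhammer a q <= 1 - a.
Proof.
move=> a01 q01; have cP := cvgP _ (cvg_real_qpochhammer a01 q01).
apply/andP; split.
  apply: limr_ge => //.
  by apply: nearW => n; exact: partial_qpochhammer_ge.
(* The upper bound [1 - a] is the partial product with a single factor. *)
have := nonincreasing_cvgn_ge
  (nonincreasing_partial_qpochhammer a01 q01) cP 1%N.
by rewrite big_nat1 expr0 mulr1.
Qed.

Lemma qpochhammer_real a q : 0 <= a < 1 -> 0 <= q < 1 ->
  qpochhammer a%:C q%:C = (real_qpochhammer a q)%:C.
Proof.
move=> a01 q01; apply: (cvg_lim (@norm_hausdorff _ R[i]^o)).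
have := cvg_real_complex (cvg_real_qpochhammer a01 q01).
apply: cvg_trans; apply: near_eq_cvg; apply: nearW => n.
rewrite rmorph_prod; apply: eq_bigr => k _.
by rewrite rmorphB rmorph1 rmorphM rmorphXn.
Qed.

(** The bounds on the product squeeze its difference quotient between two functions tending to
    [- 0 ^+ m]. Since [0 ^+ m] is 1 for [m = 0] and 0 otherwise, one formula covers both the factor
    starting at [t] and those starting at higher powers. *)
Lemma right_slope_qpochhammer m n :
  right_slope (fun t => real_qpochhammer (t ^+ m.+1) (t ^+ n.+1)) 1 (- 0 ^+ m).
Proof.
have cX k : (t ^+ k @[t --> (0 : R)^'+] --> (0 : R) ^+ k)%classic.
  by apply: cvg_at_right_filter; exact: exprn_continuous.
apply: (@squeeze_cvgr _ _ _ R (fun t => - (t ^+ m / (1 - t ^+ n.+1)))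
  (fun t => - t ^+ m)); last 2 first.
- have H : (- (t ^+ m / (1 - t ^+ n.+1)) @[t --> (0 : R)^'+]
      --> - ((0 : R) ^+ m / (1 - 0 ^+ n.+1)))%classic.
    apply: cvgN; apply: cvgM => //; apply: cvgV.
      by rewrite expr0n subr0 oner_neq0.
    by apply: cvgB => //; exact: cvg_cst.
  by rewrite [0 ^+ n.+1]expr0n subr0 divr1 in H.
- by apply: cvgN.
near=> t.
have t0 : 0 < t by near: t; exact: nbhs_right_gt.
have t1 : t < 1 by near: t; apply: nbhs_right_lt.
have X01 k : 0 <= t ^+ k.+1 < 1 by rewrite exprn_ge0 ?exprn_ilt1 // ltW.
have /andP[lb ub] := real_qpochhammer_bounds (X01 m) (X01 n).
rewrite ler_pdivlMr // ler_pdivrMr // mulNr mulNr mulrAC -exprSr.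
by apply/andP; split; lra.
Unshelve. all: by end_near. Qed.

Definition real_rogers_ramanujan q : R :=
  (real_qpochhammer q (q ^+ 5) * real_qpochhammer (q ^+ 4) (q ^+ 5)) /
  (real_qpochhammer (q ^+ 2) (q ^+ 5) * real_qpochhammer (q ^+ 3) (q ^+ 5)).

Lemma rogers_ramanujan_real q : 0 <= q < 1 ->
  rogers_ramanujan q%:C = (real_rogers_ramanujan q)%:C.
Proof.
move=> q01; have X01 k : 0 <= q ^+ k.+1 < 1.
  by rewrite exprn_ge0 ?exprn_ilt1 //; lra.
rewrite /rogers_ramanujan -!rmorphXn !qpochhammer_real //.
by rewrite -!rmorphM -fmorphV -rmorphM.
Qed.

Lemma right_slope_rogers_ramanujan m :
  right_slope (fun t => real_rogers_ramanujan (t ^+ m.+1)) 1 (- 0 ^+ m).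
Proof.
have eX k (t : R) : (t ^+ m.+1) ^+ k.+1 = t ^+ (k + m * k.+1).+1.
  by rewrite -exprM mulSn addSn.
have s k : right_slope (fun t => real_qpochhammer ((t ^+ m.+1) ^+ k.+1)
    ((t ^+ m.+1) ^+ 5)) 1 (- 0 ^+ (k + m * k.+1)).
  under eq_fun do rewrite (eX k) (eX 4%N).
  exact: right_slope_qpochhammer.
(* The products starting at the second, third and fourth powers have slope 0; only the first one can
   contribute. *)
have z k j : 0 ^+ (k.+1 + j) = 0 :> R by rewrite expr0n.
have := right_slopeM (s 1%N) (s 2%N).
rewrite !z !mulr1 oppr0 mulr0 addr0 => /right_slopeV.
move=> /(right_slopeM (right_slopeM (s 0%N) (s 3%N))).
rewrite !z muln1 add0n !mulr1 !mul1r !oppr0 !add0r.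
exact.
Qed.

End RealProducts.

(** * Comparison of the first coefficients *)

Theorem theorem1p8 (R : realType) (D : nat -> R[i])
    (hD : has_expansion
            (fun q => rogers_ramanujan (q ^+ 5) / rogers_ramanujan q ^+ 5) D) :
  0 < D 1%N.
Proof.
pose f (t : R) := real_rogers_ramanujan (t ^+ 5) / real_rogers_ramanujan t ^+ 5.
have fE t : 0 < t < 1 -> rogers_ramanujan (t%:C ^+ 5) / rogers_ramanujan t%:C ^+ 5
    = (f t)%:C.
  move=> t01; have X01 : 0 <= t ^+ 5 < 1 by rewrite exprn_ge0 ?exprn_ilt1 //; lra.
  rewrite -rmorphXn !rogers_ramanujan_real //; last by lra.
  by rewrite -rmorphXn -fmorphV -rmorphM.
have hDt t : 0 < t < 1 ->
    (series (fun n => D n * (t ^+ n)%:C : R[i]^o) @ \oo --> ((f t)%:C : R[i]^o))%classic.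
  move=> t01; rewrite -fE //.
  under [X in series X]eq_fun do rewrite rmorphXn.
  by apply: hD; rewrite normc_def /= expr0n addr0 sqrtr_sqr ltcE /= eqxx ger0_norm; lra.
have Re_slope : right_slope f (complex.Re (D 0%N)) (complex.Re (D 1%N)).
  apply: (@power_series_right_slope R (fun n => complex.Re (D n)) f) => t t01.
  have := cvg_Re (hDt t t01).
  apply: cvg_trans; apply: near_eq_cvg; apply: nearW => n.
  rewrite !seriesEnat /= raddf_sum; apply: eq_bigr => k _.
  by case: (D k) => x y /=; rewrite mulr0 subr0.
(* Positivity in [R[i]] also demands a zero imaginary part. As [f t] is real, the imaginary parts of
   the [D n] are the coefficients of a series with sum 0 on (0, 1). *)
have Im_slope : right_slope (fun=> 0) (complex.Im (D 0%N)) (complex.Im (D 1%N)).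
  apply: (@power_series_right_slope R (fun n => complex.Im (D n)) (fun=> 0)) => t t01.
  have := cvg_Im (hDt t t01).
  apply: cvg_trans; apply: near_eq_cvg; apply: nearW => n.
  rewrite !seriesEnat /= raddf_sum; apply: eq_bigr => k _.
  by case: (D k) => x y /=; rewrite mulr0 add0r.
have f_slope : right_slope f 1 5.
  (* The numerator in [t ^+ 5] has slope 0. The denominator has slope -1 before the fifth power and
     -5 after it, so its inverse has slope 5. *)
  have := right_slopeM (@right_slope_rogers_ramanujan R 4)
    (right_slopeV (right_slopeX (n := 5) (@right_slope_rogers_ramanujan R 0))).
  by rewrite !mulr1 !mul1r expr0 exprS mul0r oppr0 addr0 mulNrn opprK.
have [_ Re1] := right_slope_unique Re_slope f_slope.
have [_ Im1] := right_slope_unique Im_slope (@right_slope_cst R 0).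
by rewrite ltcE Re1 Im1 eqxx ltr0n.
Qed.
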